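(* Fix integers $m_0\ge 1$ and $1\le m\le m_0$, and let $Z_n$ be the Zagreb index of the random network $U_n$. For $n\ge 1$, $$\mathbb{E}[Z_n]=\frac{(5m^2+m)n^2-2mm_0(2m-m_0+1)\,n\log n+O(n)}{n+m_0-1}.$$ Moreover, as $n\to\infty$, $Z_n/n\to 5m^2+m$ in $L_1$, and this convergence also holds in probability.
   Context: The Zagreb index of a finite graph $G=(V,E)$ is $\sum_{v\in V}(\deg(v))^2$. The random network $U_n$ (with fixed integer parameters $m_0\ge1$, $1\le m\le m_0$) is defined as follows. At time $n=1$, $U_1$ is the complete graph on $m_0$ nodes (a single isolated node, with no self loop, if $m_0=1$). At each subsequent time $n\ge2$, a set of $m$ distinct nodes is chosen uniformly at random among all $m$-element subsets of the $n+m_0-2$ existing nodes (independently of the past given the current network), and a new node is added and joined to each of these $m$ nodes by one edge. Thus $U_n$ has $m_0+n-1$ nodes. $Z_n$ denotes the Zagreb index of $U_n$. The $O(\cdot)$ notation is as $n\to\infty$ with $m,m_0$ fixed. *)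

(* Defs.v *)
From HB Require Import structures.
From mathcomp Require Import all_boot all_order all_algebra.
From mathcomp Require Import all_classical all_reals all_analysis.

Set Implicit Arguments.
Unset Strict Implicit.
Unset Printing Implicit Defensive.

Import Order.TTheory GRing.Theory Num.Theory.
Import numFieldNormedType.Exports.

Local Open Scope classical_set_scope.
Local Open Scope ring_scope.

(* A graph with node set V is given by its set of edges, an edge being a
   two-element set of nodes. *)
Definition graph (V : finType) : finType := {set {set V}}.

Definition degree (V : finType) (G : graph V) (v : V) : nat :=
  #|[set e in G | v \in e]%SET|.

Definition zagreb (V : finType) (G : graph V) : nat :=
  (\sum_(v : V) degree G v ^ 2)%N.

Definition complete_graph (V : finType) : graph V :=
  [set e : {set V} | #|e| == 2%N]%SET.

(* The nodes of G keep their numbers 0, ..., N - 1; the new node is numbered N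
   and is joined by one edge to each node in A. *)
Definition attach (N : nat) (G : graph 'I_N) (A : {set 'I_N}) : graph 'I_N.+1 :=
  ([set lift ord_max @: e | e : {set 'I_N} in G] :|:
   [set [set lift ord_max x; ord_max] | x in A])%SET.

(* The process is U 1, U 2, ... (the value U 0 is never constrained or used);
   U n has n + m0 - 1 nodes.  For n >= 2, S n is the set of neighbours given to
   the node that enters at time n, chosen among the n + m0 - 2 nodes of
   U n.-1.  The field [choice_law] says that, conditionally on
   U 1 = h 1, ..., U n.+1 = h n.+1, the set S n.+2 is uniform among the sets of
   m nodes; it is written in product form, so that histories of probability 0
   need no special treatment. *)
Record is_random_network d (T : measurableType d) (R : realType)
    (P : probability T R) (m0 m : nat)
    (U : forall n : nat, T -> graph 'I_(n.-1 + m0))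
    (S : forall n : nat, T -> {set 'I_(n.-2 + m0)}) : Prop := {
  choice_measurable : forall (n : nat) (A : {set 'I_(n.-2 + m0)}),
    (2 <= n)%N -> measurable [set t | S n t = A];
  network_init : forall t, U 1%N t = complete_graph 'I_m0;
  network_step : forall (n : nat) t,
    U n.+2 t = attach (U n.+1 t) (S n.+2 t);
  choice_law : forall (n : nat) (h : forall k : nat, graph 'I_(k.-1 + m0))
      (A : {set 'I_(n + m0)}),
    #|A| = m ->
    P ([set t | forall k : nat, (1 <= k <= n.+1)%N -> U k t = h k] `&`
       [set t | S n.+2 t = A]) =
    (P [set t | forall k : nat, (1 <= k <= n.+1)%N -> U k t = h k] *
     (('C(n + m0, m))%:R^-1)%:E)%E
}.

Definition cvg_in_L1 d (T : measurableType d) (R : realType)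
    (P : probability T R) (X : nat -> T -> R) (c : R) : Prop :=
  ('N[P]_1[(fun t => (X n t - c)%:E)])%E @[n --> \oo] --> 0%E.

Definition cvg_in_probability d (T : measurableType d) (R : realType)
    (P : probability T R) (X : nat -> T -> R) (c : R) : Prop :=
  forall eps : R, 0 < eps ->
    P [set t | eps < `|X n t - c|] @[n --> \oo] --> 0%E.

(* Main.v *)
(* Attaching a new node to the set A raises the Zagreb index by
   2 * (sum of the degrees in A) + m + m ^ 2, and the total degree is
   deterministic, so averaging over A gives an exact recursion for the mean of
   Z_n, whose solution is affine in n up to a multiple of
   1/m0 + ... + 1/(n + m0 - 2); comparison with log n yields the expansion.
   For the convergence, the same recursion for the centred second moment and
   the Cauchy-Schwarz inequality show that each step adds at most
   4 m ^ 2 E[Z_n] / (number of nodes) = O(1), hence Var Z_n = O(n) and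
   E|Z_n / n - (5 m ^ 2 + m)| = O(1 / sqrt n). *)
Require Import Defs.
From HB Require Import structures.
From mathcomp Require Import all_boot all_order all_algebra.
From mathcomp Require Import all_classical all_reals all_analysis.
From mathcomp Require Import ring lra zify.

Set Implicit Arguments.
Unset Strict Implicit.
Unset Printing Implicit Defensive.

Import Order.TTheory GRing.Theory Num.Theory.
Import numFieldNormedType.Exports.

Local Open Scope classical_set_scope.
Local Open Scope ring_scope.

(** * Degrees and the Zagreb index under attachment, and for complete graphs *)

Lemma ord_max_eq_lift n (x : 'I_n) : (ord_max == lift ord_max x) = false.
Proof. exact/negbTE/neq_lift. Qed.

(** Every new edge contains [ord_max] and no lifted edge does, so the lifted edges of the result are
    exactly those of [G]. This later lets a graph determine its whole past. *)
Lemma attach_inj N (G G' : graph 'I_N) A A' :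
  attach G A = attach G' A' -> G = G'.
Proof.
have old (H : graph 'I_N) B (e : {set 'I_N}) :
    ((lift ord_max @: e : {set 'I_N.+1}) \in attach H B) = (e \in H).
  rewrite inE mem_imset; last exact/imset_inj/lift_inj.
  rewrite orbC; case: imsetP => // -[x _ eE].
  have : ord_max \in [set lift ord_max x; ord_max]%SET by rewrite !inE eqxx orbT.
  by rewrite -eE => /imsetP[y _ /eqP]; rewrite ord_max_eq_lift.
by move=> GG'; apply/setP => e; rewrite -(old G A) GG' old.
Qed.

Lemma set2_lift_inj N :
  injective (fun x : 'I_N => [set lift ord_max x; ord_max]%SET).
Proof.
move=> x y /setP /(_ (lift ord_max x)); rewrite !inE eqxx /=.
by rewrite [_ == ord_max]eq_sym ord_max_eq_lift orbF => /esym/eqP /lift_inj.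
Qed.

Lemma degree_attach_max N (G : graph 'I_N) (A : {set 'I_N}) :
  degree (attach G A) ord_max = #|A|.
Proof.
rewrite /degree -(card_imset (mem A) (@set2_lift_inj N)).
apply: eq_card => e; rewrite !inE.
apply/andP/idP => [[/orP[/imsetP[f _ ->] /imsetP[y _ /eqP]|//]]|eA].
  by rewrite ord_max_eq_lift.
by split; [rewrite eA orbT|case/imsetP: eA => x _ ->; rewrite !inE eqxx orbT].
Qed.

Lemma degree_attach_lift N (G : graph 'I_N) (A : {set 'I_N}) v :
  degree (attach G A) (lift ord_max v) = (degree G v + (v \in A))%N.
Proof.
rewrite /degree.
have -> : [set e in attach G A | lift ord_max v \in e]%SET =
   ([set lift ord_max @: (e : {set 'I_N}) | e in [set e in G | v \in e]] :|:
    [set [set lift ord_max x; ord_max] | x in A :&: [set v]])%SET.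
  apply/setP => e; rewrite !inE; apply/idP/idP.
    case/andP=> /orP[/imsetP[f fG ->]|/imsetP[x xA ->]].
      by rewrite (mem_imset _ _ (@lift_inj _ _)) => vf; rewrite imset_f// inE fG.
    rewrite !inE [_ == ord_max]eq_sym ord_max_eq_lift orbF => /eqP/lift_inj vx.
    by apply/orP; right; apply/imset_f; rewrite !inE xA vx eqxx.
  case/orP=> /imsetP[f]; rewrite !inE => /andP[fG vf] ->.
    by rewrite imset_f// (mem_imset _ _ (@lift_inj _ _)) vf.
  move/eqP: vf fG => -> vA; rewrite !inE eqxx/= andbT.
  by apply/orP; right; apply/imset_f.
(* The two families of edges are disjoint, since only new edges contain [ord_max]. *)
rewrite cardsU [X in (_ - X)%N](_ : _ = 0%N) ?subn0; last first.
  apply/eqP; rewrite cards_eq0; apply/set0Pn => -[e].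
  rewrite inE => /andP[/imsetP[f _ ->] /imsetP[x _ /setP/(_ ord_max)]].
  rewrite !inE eqxx orbT => /imsetP[y _ /eqP].
  by rewrite ord_max_eq_lift.
congr addn.
  by rewrite card_imset//; exact/imset_inj/lift_inj.
rewrite card_imset; last exact: set2_lift_inj.
case vA: (v \in A).
  by rewrite (finset.setIidPr _) ?cards1// finset.sub1set.
by apply/eqP; rewrite cards_eq0 finset.setI_eq0 disjoint_sym disjoints1 vA.
Qed.

Definition degree_sum (V : finType) (G : graph V) (A : {set V}) : nat :=
  (\sum_(v in A) degree G v)%N.

Lemma degree_sum_attach N (G : graph 'I_N) (A : {set 'I_N}) :
  degree_sum (attach G A) [set: _]%SET = (degree_sum G [set: _]%SET + 2 * #|A|)%N.
Proof.
rewrite /degree_sum !(eq_bigl _ _ (@finset.in_setT _)) (bigD1 ord_max)//=.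
rewrite degree_attach_max.
have -> : (\sum_(i < N.+1 | i != ord_max) degree (attach G A) i =
   \sum_(v < N) (degree G v + (v \in A)))%N.
  rewrite [LHS]big_mkcond big_ord_recr/= eqxx addn0; apply: eq_bigr => i _.
  have -> : widen_ord (leqnSn N) i = lift ord_max i.
    by apply: val_inj; rewrite /= /bump leqNgt ltn_ord.
  by rewrite eq_sym neq_lift degree_attach_lift.
by rewrite big_split/= -big_mkcond/= sum1_card addnCA mul2n addnn.
Qed.

(** The new node contributes [#|A| ^ 2], and a chosen node of degree [d] gains
    [(d + 1) ^ 2 - d ^ 2 = 2 * d + 1]. *)
Lemma zagreb_attach N (G : graph 'I_N) (A : {set 'I_N}) :
  zagreb (attach G A) = (zagreb G + 2 * degree_sum G A + #|A| + #|A| ^ 2)%N.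
Proof.
rewrite /zagreb (bigD1 ord_max)//= degree_attach_max.
have -> : (\sum_(i < N.+1 | i != ord_max) degree (attach G A) i ^ 2 =
   \sum_(v < N) (degree G v ^ 2 + if v \in A then 2 * degree G v + 1 else 0))%N.
  rewrite [LHS]big_mkcond big_ord_recr/= eqxx addn0; apply: eq_bigr => i _.
  have -> : widen_ord (leqnSn N) i = lift ord_max i.
    by apply: val_inj; rewrite /= /bump leqNgt ltn_ord.
  rewrite eq_sym neq_lift degree_attach_lift; case: (i \in A) => /=; lia.
rewrite big_split/= -big_mkcond/= big_split/= sum1_card -big_distrr/=.
by rewrite /degree_sum addnC !addnA.
Qed.

Lemma degree_complete N (v : 'I_N) : degree (complete_graph 'I_N) v = N.-1.
Proof.
have inj : {in [set~ v]%SET &, injective (fun x => [set v; x]%SET)}.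
  move=> x y; rewrite !inE => xv yv /setP/(_ x); rewrite !inE eqxx orbT.
  by rewrite (negbTE xv) /= => /esym/eqP.
rewrite /degree -[RHS](_ : #|[set~ v]%SET| = N.-1)%N; last first.
  by rewrite cardsC1 card_ord.
rewrite -(card_in_imset inj) ; apply: eq_card => e; rewrite !inE.
apply/andP/imsetP => [[/cards2P[x [y [xy ->]]]]|[x]].
  rewrite !inE => /orP[]/eqP ->; [exists y|exists x]; rewrite ?inE//.
    by rewrite eq_sym.
  by rewrite finset.setUC.
rewrite !inE => xv ->; rewrite cards2 [v == x]eq_sym xv; split => //.
by rewrite !inE eqxx.
Qed.

Lemma zagreb_complete N : zagreb (complete_graph 'I_N) = (N * N.-1 ^ 2)%N.
Proof.
rewrite /zagreb (eq_bigr (fun=> N.-1 ^ 2)%N); last first.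
  by move=> v _; rewrite degree_complete.
by rewrite sum_nat_const card_ord.
Qed.

Lemma degree_sum_complete N :
  degree_sum (complete_graph 'I_N) [set: _]%SET = (N * N.-1)%N.
Proof.
rewrite /degree_sum (eq_bigr (fun=> N.-1)%N); last first.
  by move=> v _; rewrite degree_complete.
by rewrite sum_nat_const cardsT card_ord.
Qed.

(** * Averages over uniformly drawn sets of [m] nodes *)

Lemma sum_draws (R : comPzSemiRingType) N m (f : 'I_N.+1 -> R) :
  \sum_(A : {set 'I_N.+1} | #|A| == m.+1) \sum_(v in A) f v =
  'C(N, m)%:R * \sum_v f v.
Proof.
rewrite (exchange_big_dep xpredT)//= mulr_sumr; apply: eq_bigr => v _.
rewrite sumr_const -[LHS]mulr_natl; congr (_%:R * _).
(* Pascal's rule: of all sets of [m.+1] nodes, ['C(N, m.+1)] avoid [v], so ['C(N, m)] contain it. *)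
have := card_draws 'I_N.+1 m.+1; rewrite card_ord binS.
rewrite -(cardsID [set A : {set 'I_N.+1} | v \in A]%SET) => /eqP.
have -> : #|([set A : {set 'I_N.+1} | #|A| == m.+1] :\:
             [set A : {set 'I_N.+1} | v \in A])%SET| = 'C(N, m.+1).
  rewrite -[in RHS](_ : #|[set~ v]%SET| = N)%N; last by rewrite cardsC1 card_ord.
  rewrite -cards_draws; apply: eq_card => A; rewrite !inE.
  by congr andb; rewrite finset.subsetC finset.sub1set inE.
rewrite addnC eqn_add2l => /eqP <-.
by apply: eq_card => A; rewrite !inE.
Qed.

Section DrawMean.
Variables (R : realType) (m N : nat).
Implicit Types F G : {set 'I_N} -> R.

Definition draw_mean F : R :=
  'C(N, m)%:R^-1 * \sum_(A : {set 'I_N} | #|A| == m) F A.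

Lemma eq_draw_mean F G :
  (forall A : {set 'I_N}, #|A| = m -> F A = G A) -> draw_mean F = draw_mean G.
Proof.
by move=> FG; congr (_ * _); apply: eq_bigr => A /eqP; exact: FG.
Qed.

Lemma ler_draw_mean F G :
  (forall A : {set 'I_N}, #|A| = m -> F A <= G A) -> draw_mean F <= draw_mean G.
Proof.
move=> FG; rewrite ler_wpM2l ?invr_ge0//.
by apply: ler_sum => A /eqP; exact: FG.
Qed.

Lemma draw_meanD F G :
  draw_mean (fun A => F A + G A) = draw_mean F + draw_mean G.
Proof. by rewrite -mulrDr -big_split. Qed.

Lemma draw_meanZ a F : draw_mean (fun A => a * F A) = a * draw_mean F.
Proof. by rewrite /draw_mean mulrCA -mulr_sumr. Qed.

Lemma draw_mean_cst a : (m <= N)%N -> draw_mean (fun=> a) = a.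
Proof.
move=> mN; rewrite /draw_mean sumr_const.
have -> : #|[pred A : {set 'I_N} | #|A| == m]| = 'C(N, m).
  by rewrite -[N in RHS]card_ord -card_draws; apply: eq_card => A; rewrite !inE.
rewrite -[a *+ _]mulr_natl mulrA mulVf ?mul1r// pnatr_eq0 -lt0n.
by rewrite bin_gt0.
Qed.

End DrawMean.

(** A given node is drawn with probability [m / N], by the absorption identity for binomial
    coefficients. *)
Lemma draw_mean_sum (R : realType) m N (f : 'I_N -> R) : (0 < m <= N)%N ->
  draw_mean m (fun A : {set 'I_N} => \sum_(v in A) f v) =
  m%:R / N%:R * \sum_v f v.
Proof.
case: m N f => // m [//|N] f mN; rewrite /draw_mean sum_draws mulrA.
congr (_ * _); apply/eqP; rewrite [X in X == _]mulrC eqr_div ?pnatr_eq0//; last first.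
  by rewrite -lt0n bin_gt0.
rewrite -!natrM; apply/eqP; congr (_%:R).
by have := mul_bin_diag N.+1 m; rewrite /= mulnC => ->; rewrite mulnC.
Qed.

(** * Recursions for the mean and the variance of the Zagreb index *)

Section ProcessMean.
Variables (R : realType) (m0 m : nat).

(* The expectation of F (U n.+1), computed one step at a time. *)
Fixpoint process_mean (n : nat) : (graph 'I_(n + m0) -> R) -> R :=
  match n return (graph 'I_(n + m0) -> R) -> R with
  | 0 => fun F => F (complete_graph 'I_m0)
  | n'.+1 => fun F =>
      process_mean (fun G => draw_mean m (fun A => F (attach G A)))
  end.

Definition total_degree n : nat := (m0 * m0.-1 + 2 * m * n)%N.

(* The total degree of U n.+1 is deterministic, so only graphs with that total
   degree matter. *)
Lemma ler_process_mean n (F G : graph 'I_(n + m0) -> R) :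
  (forall g, degree_sum g [set: _]%SET = total_degree n -> F g <= G g) ->
  process_mean F <= process_mean G.
Proof.
elim: n F G => [|n IHn] F G FG /=.
  by apply: FG; rewrite degree_sum_complete /total_degree muln0 addn0.
apply: IHn => g gn; apply: ler_draw_mean => A Am.
by apply: FG; rewrite degree_sum_attach gn Am /total_degree; lia.
Qed.

Lemma eq_process_mean n (F G : graph 'I_(n + m0) -> R) :
  (forall g, degree_sum g [set: _]%SET = total_degree n -> F g = G g) ->
  process_mean F = process_mean G.
Proof.
move=> FG; apply/eqP; rewrite eq_le; apply/andP.
by split; apply: ler_process_mean => g /FG ->.
Qed.

Lemma process_meanD n (F G : graph 'I_(n + m0) -> R) :
  process_mean (fun g => F g + G g) = process_mean F + process_mean G.
Proof.
elim: n F G => //= n IHn F G; rewrite -IHn.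
by apply: eq_process_mean => g _; exact: draw_meanD.
Qed.

Lemma process_meanZ n a (F : graph 'I_(n + m0) -> R) :
  process_mean (fun g => a * F g) = a * process_mean F.
Proof.
elim: n F => //= n IHn F; rewrite -IHn.
by apply: eq_process_mean => g _; exact: draw_meanZ.
Qed.

Hypothesis m_gt0 : (0 < m)%N.
Hypothesis m_le : (m <= m0)%N.

Let m_size n : (m <= n + m0)%N.
Proof. by rewrite (leq_trans m_le) ?leq_addl. Qed.

Lemma process_mean_cst n a : process_mean (fun _ : graph 'I_(n + m0) => a) = a.
Proof.
elim: n => //= n IHn; rewrite -[RHS]IHn.
by apply: eq_process_mean => g _; exact: draw_mean_cst.
Qed.

Definition zagreb_mean n : R :=
  process_mean (fun g : graph 'I_(n + m0) => (zagreb g)%:R).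

Definition zagreb_incr n : R :=
  m%:R + m%:R ^+ 2 + 2 * (m%:R / (n + m0)%:R * (total_degree n)%:R).

Lemma draw_mean_degree_sum n (g : graph 'I_(n + m0)) :
  degree_sum g [set: _]%SET = total_degree n ->
  draw_mean m (fun A => (degree_sum g A)%:R : R) =
  m%:R / (n + m0)%:R * (total_degree n)%:R.
Proof.
move=> gn; rewrite (eq_draw_mean (G := fun A : {set 'I_(n + m0)} =>
  \sum_(v in A) (degree g v)%:R)); last by move=> A _; rewrite natr_sum.
rewrite draw_mean_sum ?m_gt0 ?m_size// -natr_sum -gn /degree_sum.
by rewrite (eq_bigl _ _ (@finset.in_setT _)).
Qed.

Lemma zagreb_attachR n (g : graph 'I_(n + m0)) (A : {set 'I_(n + m0)}) : #|A| = m ->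
  (zagreb (attach g A))%:R =
  (zagreb g)%:R + (m%:R + m%:R ^+ 2 + 2 * (degree_sum g A)%:R) :> R.
Proof. by move=> Am; rewrite zagreb_attach Am !natrD natrX; ring. Qed.

(** Given the current graph, the mean increment depends on it only through its total degree, which
    is deterministic; hence the recursion is closed. *)
Lemma zagreb_meanS n : zagreb_mean n.+1 = zagreb_mean n + zagreb_incr n.
Proof.
rewrite -[zagreb_incr n](process_mean_cst n) -process_meanD.
rewrite {1}/zagreb_mean /=; apply: eq_process_mean => g gn.
rewrite (eq_draw_mean (zagreb_attachR g)) draw_meanD draw_mean_cst//.
by rewrite draw_meanD draw_mean_cst// draw_meanZ draw_mean_degree_sum.
Qed.

(** Cauchy-Schwarz against the constant 1, read off from the nonnegative double sum of
    [(f i - f j) ^ 2]. *)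
Lemma sqr_sum_le (I : finType) (A : {set I}) (f : I -> R) :
  (\sum_(i in A) f i) ^+ 2 <= #|A|%:R * \sum_(i in A) f i ^+ 2.
Proof.
have : 0 <= \sum_(i in A) \sum_(j in A) (f i - f j) ^+ 2.
  by apply: sumr_ge0 => i _; apply: sumr_ge0 => j _; exact: sqr_ge0.
rewrite (eq_bigr (fun i => #|A|%:R * f i ^+ 2 + \sum_(j in A) f j ^+ 2 -
   2 * f i * \sum_(j in A) f j)); last first.
  move=> i _; rewrite mulr_natl -sumr_const mulr_sumr -big_split/= -sumrB.
  by apply: eq_bigr => j _; ring.
rewrite sumrB big_split/= sumr_const -mulr_sumr -mulr_suml -mulr_sumr.
by rewrite -[_ *+ #|A|]mulr_natl expr2; lra.
Qed.

Definition zagreb_var n : R :=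
  process_mean (fun g : graph 'I_(n + m0) =>
    ((zagreb g)%:R - zagreb_mean n) ^+ 2).

(* The increment of the centred index is twice the centred sum of the degrees
   of the chosen nodes; its second moment is controlled through the
   Cauchy-Schwarz inequality by the mean of the Zagreb index itself. *)
Lemma zagreb_varS n :
  zagreb_var n.+1 <=
  zagreb_var n + 4 * m%:R ^+ 2 / (n + m0)%:R * zagreb_mean n.
Proof.
rewrite -process_meanZ -process_meanD {1}/zagreb_var /=.
apply: ler_process_mean => g gn /=.
set x := (zagreb g)%:R - zagreb_mean n.
set mu := m%:R / (n + m0)%:R * (total_degree n)%:R : R.
(* The centred index becomes [x + 2 * (degree_sum g A - mu)]; its square is sorted by powers of
   [degree_sum g A], whose mean over [A] is [mu]. *)
rewrite (eq_draw_mean (G := fun A => (x ^+ 2 - 4 * x * mu + 4 * mu ^+ 2) +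
   ((4 * x - 8 * mu) * (degree_sum g A)%:R +
   4 * (degree_sum g A)%:R ^+ 2))); last first.
  move=> A Am; rewrite zagreb_attachR// zagreb_meanS /zagreb_incr -/mu /x.
  ring.
rewrite draw_meanD draw_mean_cst// draw_meanD !draw_meanZ draw_mean_degree_sum//.
rewrite -/mu.
have : draw_mean m (fun A => (degree_sum g A)%:R ^+ 2 : R) <=
    m%:R * (m%:R / (n + m0)%:R * (zagreb g)%:R).
  rewrite natr_sum -draw_mean_sum ?m_gt0 ?m_size// -draw_meanZ.
  apply: ler_draw_mean => A Am.
  rewrite natr_sum -[m in m%:R * _]Am
    [X in _ <= _ * X](eq_bigr (fun v => (degree g v)%:R ^+ 2)).
    exact: sqr_sum_le.
  by move=> v _; rewrite natrX.
(* The cross terms cancel, leaving [x ^+ 2 + 4 * D - 4 * mu ^+ 2]; the last term is simply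
   dropped. *)
set D := draw_mean _ _ => DB; have := sqr_ge0 mu.
have -> : 4 * m%:R ^+ 2 / (n + m0)%:R * (zagreb g)%:R =
  4 * (m%:R * (m%:R / (n + m0)%:R * (zagreb g)%:R)) :> R by ring.
have -> : x ^+ 2 - 4 * x * mu + 4 * mu ^+ 2 + ((4 * x - 8 * mu) * mu + 4 * D) =
  x ^+ 2 + (4 * D - 4 * mu ^+ 2) by ring.
lra.
Qed.

End ProcessMean.

(** * Shifted harmonic sums compared with the logarithm *)

Section Asymptotics.
Variable R : realType.

Lemma lnD1_sub_le (x : R) : 0 < x -> ln (x + 1) - ln x <= x^-1.
Proof.
move=> x0; rewrite -ln_div ?posrE ?addr_gt0// mulrDl divff ?gt_eqF// mul1r.
by apply: le_ln1Dx; rewrite (lt_trans _ (_ : 0 < _)) ?invr_gt0 ?ltrN10.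
Qed.

Lemma le_lnD1_sub (x : R) : 0 < x -> (x + 1)^-1 <= ln (x + 1) - ln x.
Proof.
move=> x0; have x10 : 0 < x + 1 by rewrite addr_gt0.
have -> : ln (x + 1) - ln x = - ln (1 + - (x + 1)^-1).
  have -> : 1 + - (x + 1)^-1 = x / (x + 1) by field; rewrite gt_eqF.
  by rewrite ln_div ?posrE// opprB.
rewrite lerNr; apply: le_ln1Dx.
by rewrite ltrN2 invf_lt1// ltrDr.
Qed.

Definition shifted_harmonic (a n : nat) : R := \sum_(j < n) (j + a)%:R^-1.

Lemma shifted_harmonicS a n :
  shifted_harmonic a n.+1 = shifted_harmonic a n + (n + a)%:R^-1.
Proof. by rewrite /shifted_harmonic big_ord_recr. Qed.

Lemma shifted_harmonic_ge0 a n : 0 <= shifted_harmonic a n.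
Proof. by apply: sumr_ge0 => j _; rewrite invr_ge0. Qed.

Lemma shifted_harmonic_le a n : (0 < a)%N ->
  shifted_harmonic a n <= 1 + ln n.+1%:R.
Proof.
(* The extra term [1 / (n + 1)] makes the induction close: it absorbs [1 / (n + a)], and
   [le_lnD1_sub] pays for the next one, [1 / (n + 2)]. *)
move=> a0; suff : shifted_harmonic a n + n.+1%:R^-1 <= 1 + ln n.+1%:R :> R.
  by apply: le_trans; rewrite lerDl invr_ge0.
elim: n => [|n IHn].
  by rewrite /shifted_harmonic big_ord0 add0r invr1 ln1 addr0.
have : (n + a)%:R^-1 <= n.+1%:R^-1 :> R.
  by rewrite lef_pV2 ?posrE ?ltr0n ?ler_nat; lia.
have := @le_lnD1_sub n.+1%:R (ltr0Sn _ _).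
rewrite natr1 shifted_harmonicS.
move: (n.+2%:R^-1) (n.+1%:R^-1) ((n + a)%:R^-1) (ln n.+2%:R) (ln n.+1%:R) IHn => *.
lra.
Qed.

Lemma shifted_harmonic_ge a n : (0 < a)%N ->
  ln n.+1%:R - ln a%:R <= shifted_harmonic a n.
Proof.
(* With [n + a] in place of [n.+1] the bound is stronger, and its induction step is [lnD1_sub_le] at
   [n + a]. *)
move=> a0; suff : ln (n + a)%:R - ln a%:R <= shifted_harmonic a n.
  apply: le_trans; rewrite lerB// ler_ln ?posrE ?ltr0n ?ler_nat; lia.
elim: n => [|n IHn]; first by rewrite /shifted_harmonic big_ord0 add0n subrr.
have na0 : 0 < (n + a)%:R :> R by rewrite ltr0n; lia.
have := lnD1_sub_le na0; rewrite natr1 shifted_harmonicS addSn => ?; lra.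
Qed.

(** With [s] the square root of [n + 1], [ln (s ^ 2) = 2 * ln s <= 2 * (s - 1)], so the sum is at
    most [2 * s]. The squared logarithmic bias of the mean is thereby [O(n)], like the variance. *)
Lemma shifted_harmonic_sqr_le a n : (0 < a)%N ->
  shifted_harmonic a n ^+ 2 <= 4 * n.+1%:R.
Proof.
move=> a0; set x : R := n.+1%:R; have x0 : 0 < x by rewrite ltr0n.
set s := Num.sqrt x; have s0 : 0 < s by rewrite sqrtr_gt0.
have xs : x = s ^+ 2 by rewrite sqr_sqrtr// ltW.
have : shifted_harmonic a n <= 2 * s.
  apply: (le_trans (shifted_harmonic_le n a0)); rewrite -/x xs lnXn//.
  have := @le_ln1Dx _ (s - 1).
  rewrite [1 + _]addrC subrK ltrBrDr addNr => /(_ s0) ?; rewrite mulr2n; lra.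
have := shifted_harmonic_ge0 a n; rewrite xs => ? ?; nra.
Qed.

Lemma shifted_harmonic_le_nat a n : (0 < a)%N ->
  shifted_harmonic a n <= n.+1%:R.
Proof.
move=> a0; apply: (le_trans (shifted_harmonic_le n a0)).
have n0 : 0 < n.+1%:R :> R by rewrite ltr0n.
have := @le_ln1Dx _ (n.+1%:R - 1 : R).
rewrite [1 + _]addrC subrK ltrBrDr addNr => /(_ n0) ?; lra.
Qed.

End Asymptotics.

(** * Explicit mean and quantitative bounds for the Zagreb index *)

Section ZagrebMoments.
Variables (R : realType) (m0 m : nat).
Hypothesis m_gt0 : (0 < m)%N.
Hypothesis m_le : (m <= m0)%N.

Let c : R := 5 * m%:R ^+ 2 + m%:R.
Let kappa : R := 2 * m%:R * m0%:R * (2 * m%:R - m0%:R + 1).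
Let z0 : R := (m0 * m0.-1 ^ 2)%:R.

Let m0_gt0 : (0 < m0)%N. Proof. lia. Qed.

(** Partial fractions turn [zagreb_incr n] into [c - kappa / (n + m0)], which is then summed. The
    index [n] refers to [U n.+1]. *)
Lemma zagreb_meanE n :
  zagreb_mean R m0 m n = z0 + c * n%:R - kappa * shifted_harmonic R m0 n.
Proof.
elim: n => [|n IHn].
  by rewrite /zagreb_mean/= zagreb_complete /shifted_harmonic big_ord0; ring.
rewrite zagreb_meanS// IHn shifted_harmonicS /zagreb_incr /total_degree.
have nm0 : n%:R + m0%:R != 0 :> R by rewrite -natrD pnatr_eq0; lia.
have m0E : m0%:R = m0.-1%:R + 1 :> R by rewrite natr1 prednK.
move: nm0; rewrite /kappa /c -[n.+1%:R]natr1 !natrD !natrM m0E => nm0.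
by field.
Qed.

(** The bound is stated with [n + m0], the denominator in [zagreb_varS], so that each variance
    increment is at most a constant. *)
Lemma zagreb_mean_le :
  exists2 K, 0 <= K & forall n, zagreb_mean R m0 m n <= K * (n + m0)%:R.
Proof.
have c0 : 0 <= c by rewrite addr_ge0 ?mulr_ge0.
exists (z0 + c + `|kappa|) => [|n]; first by rewrite !addr_ge0.
have xN : n.+1%:R <= (n + m0)%:R :> R by rewrite ler_nat; lia.
apply: (@le_trans _ _ ((z0 + c + `|kappa|) * n.+1%:R)); last first.
  by rewrite ler_wpM2l// !addr_ge0.
rewrite zagreb_meanE (mulrDl (z0 + c)) (mulrDl z0); apply: lerD; first apply: lerD.
- by rewrite ler_peMr// ler1n.
- by rewrite ler_wpM2l// ler_nat.
rewrite (le_trans (ler_norm _))// normrN normrM ler_wpM2l//.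
by rewrite ger0_norm ?shifted_harmonic_ge0// shifted_harmonic_le_nat.
Qed.

Lemma zagreb_var_le :
  exists2 K, 0 <= K & forall n, zagreb_var R m0 m n <= K * n%:R.
Proof.
have [K K0 meanK] := zagreb_mean_le.
exists (4 * m%:R ^+ 2 * K) => [|n]; first by rewrite !mulr_ge0.
elim: n => [|n IHn]; first by rewrite mulr0 /zagreb_var/= subrr expr0n.
apply: (le_trans (zagreb_varS R m_gt0 m_le n)).
rewrite -[n.+1%:R]natr1 mulrDr mulr1 lerD// -!mulrA !ler_wpM2l//.
by rewrite mulrC ler_pdivrMr ?meanK// ltr0n; lia.
Qed.

(** Squared distance is at most twice the variance plus twice the squared bias. The bias
    [z0 - c - kappa * H] is logarithmic, so both parts are linear in [n]. *)
Lemma zagreb_sqr_dist_le : exists K, forall n,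
  process_mean m (fun g : graph 'I_(n + m0) =>
    ((zagreb g)%:R - c * n.+1%:R) ^+ 2) <= K * n.+1%:R.
Proof.
have [K K0 varK] := zagreb_var_le.
exists (2 * K + (4 * (z0 - c) ^+ 2 + 16 * kappa ^+ 2)) => n.
set x : R := n.+1%:R; have x1 : 1 <= x by rewrite ler1n.
set mu := zagreb_mean R m0 m n; set H := shifted_harmonic R m0 n.
have muE : mu - c * x = z0 - c - kappa * H.
  by rewrite /mu zagreb_meanE -/H /x -[n.+1%:R]natr1; ring.
apply: (@le_trans _ _ (2 * zagreb_var R m0 m n + 2 * (mu - c * x) ^+ 2)).
  rewrite -process_meanZ -[X in _ + X](process_mean_cst m_le n).
  rewrite -process_meanD; apply: ler_process_mean => g _.
  rewrite -/mu; set z := (zagreb g)%:R.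
  (* This is [(u + v) ^ 2 <= 2 * u ^ 2 + 2 * v ^ 2] with [u = z - mu] and [v = mu - c * x]. *)
  by have := sqr_ge0 (z - mu - (mu - c * x)); nra.
have KH : (kappa * H) ^+ 2 <= kappa ^+ 2 * (4 * x).
  by rewrite exprMn ler_wpM2l ?sqr_ge0// shifted_harmonic_sqr_le.
have -> : (2 * K + (4 * (z0 - c) ^+ 2 + 16 * kappa ^+ 2)) * x =
  2 * (K * x) + (4 * ((z0 - c) ^+ 2 * x) + 4 * (kappa ^+ 2 * (4 * x))) by ring.
apply: lerD.
  by rewrite ler_wpM2l// (le_trans (varK n))// ler_wpM2l// ler_nat.
have : (z0 - c) ^+ 2 <= (z0 - c) ^+ 2 * x by rewrite ler_peMr ?sqr_ge0.
move: KH; rewrite muE; set A := kappa ^+ 2 * _; set B := (z0 - c) ^+ 2 * x.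
set u := kappa * H; set v := z0 - c => uA vB.
by have := sqr_ge0 (u + v); nra.
Qed.

(* For s = sqrt x, AM-GM gives [|y / x| <= (1 + y ^ 2 / x) / s]. *)
Lemma zagreb_abs_dist_le : exists K, forall n,
  process_mean m (fun g : graph 'I_(n + m0) =>
    `|(zagreb g)%:R / n.+1%:R - c|) <= K / Num.sqrt n.+1%:R.
Proof.
have [K distK] := zagreb_sqr_dist_le; exists (1 + K) => n; have := distK n.
set x : R := n.+1%:R; have x0 : 0 < x by rewrite ltr0n.
set s := Num.sqrt x; have s0 : 0 < s by rewrite sqrtr_gt0.
have xs : x = s ^+ 2 by rewrite sqr_sqrtr// ltW.
move=> sqK.
apply: (@le_trans _ _ (process_mean m (fun g : graph 'I_(n + m0) =>
    s^-1 + (s^-1 / x) * ((zagreb g)%:R - c * x) ^+ 2))).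
  apply: ler_process_mean => // g _; set y := (zagreb g)%:R - c * x.
  have -> : (zagreb g)%:R / x - c = y / x.
    by rewrite /y; field; rewrite gt_eqF.
  have -> : `|y / x| = s^-1 * `|y / s|.
    rewrite !normrM !normfV (gtr0_norm x0) (gtr0_norm s0) xs.
    by field; rewrite gt_eqF.
  have -> : s^-1 + s^-1 / x * y ^+ 2 = s^-1 * (1 + `|y / s| ^+ 2).
    rewrite real_normK ?num_real// xs.
    by field; rewrite gt_eqF.
  rewrite ler_wpM2l ?invr_ge0 ?ltW//.
  by have := sqr_ge0 (`|y / s| - 1); have := normr_ge0 (y / s); nra.
rewrite process_meanD process_mean_cst// process_meanZ [leRHS]mulrDl mul1r lerD//.
rewrite -[leLHS]mulrA [leRHS]mulrC ler_wpM2l ?invr_ge0 ?(ltW s0)//.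
by rewrite ler_pdivrMl// [leRHS]mulrC.
Qed.

Lemma zagreb_mean_asymp : exists2 K, 0 <= K & forall n,
  `|zagreb_mean R m0 m n * (n.+1%:R + m0%:R - 1) -
    (c * n.+1%:R ^+ 2 - kappa * (n.+1%:R * ln n.+1%:R))| <= K * n.+1%:R.
Proof.
(* [U n.+1] has [n.+1 + a] nodes, and [B] bounds the gap between the harmonic sum and the logarithm,
   which lies between [- ln m0] and 1. *)
pose a : R := m0.-1%:R; pose B : R := 1 + `|ln m0%:R|.
have a0 : 0 <= a by exact: ler0n.
have B0 : 0 <= B by rewrite addr_ge0.
exists (`|z0 - c + c * a| + a * `|z0 - c| + `|kappa| * B + `|kappa| * a) => [|n].
  by do ![apply: addr_ge0 | apply: mulr_ge0].
set H := shifted_harmonic R m0 n; set x : R := n.+1%:R.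
have x1 : 1 <= x by rewrite ler1n.
have x0 : 0 <= x by rewrite ler0n.
have m0E : m0%:R = a + 1 by rewrite natr1 prednK.
(* The error splits exactly into four terms, each bounded by one summand of the witness times
   [x]. *)
have -> : zagreb_mean R m0 m n * (x + m0%:R - 1) -
    (c * x ^+ 2 - kappa * (x * ln x)) =
  (z0 - c + c * a) * x + a * (z0 - c) - kappa * x * (H - ln x) - kappa * a * H.
  rewrite zagreb_meanE m0E -/H (_ : n%:R = x - 1); first by ring.
  by rewrite /x -natr1 addrK.
rewrite [leRHS]mulrDl [X in _ <= X + _]mulrDl [X in _ <= X + _ + _]mulrDl.
rewrite (le_trans (ler_normB _ _))// lerD//; last first.
  rewrite (normrM (kappa * a)) (normrM kappa) (ger0_norm a0) ler_wpM2l ?mulr_ge0//.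
  by rewrite ger0_norm ?shifted_harmonic_ge0// shifted_harmonic_le_nat.
rewrite (le_trans (ler_normB _ _))// lerD//; last first.
  rewrite (normrM (kappa * x)) (normrM kappa) (ger0_norm x0).
  rewrite -(mulrA _ x) -(mulrA _ B) ler_wpM2l// mulrC ler_wpM2r//.
  have := shifted_harmonic_le R n m0_gt0; have := shifted_harmonic_ge R n m0_gt0.
  rewrite -/H -/x ler_norml /B.
  have := ler_norm (ln m0%:R : R); set h := `|_|; set k := ln m0%:R.
  set l := ln x => ? ? ?; have : 0 <= h by exact: normr_ge0.
  by move=> ?; apply/andP; split; lra.
rewrite (le_trans (ler_normD _ _))// lerD//.
  by rewrite normrM (ger0_norm x0).
by rewrite normrM (ger0_norm a0) ler_peMr// mulr_ge0.
Qed.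

End ZagrebMoments.

(** * Measurability and expectation for finite-valued random variables *)

Section FiniteValued.
Context d (T : measurableType d) (R : realType) (P : probability T R).
Context (I : finType) (X : T -> I).
Hypothesis mX : forall i, measurable [set t | X t = i].

Lemma measurable_finite_preimage (Q : set I) : measurable (X @^-1` Q).
Proof.
rewrite [X @^-1` Q](_ : _ = \bigcup_(i in Q) [set t | X t = i]).
  by apply: fin_bigcup_measurable => [|i _]; [exact: finite_finset|exact: mX].
by apply/seteqP; split=> [t Qt|t [i Qi /= ->]]//=; exists (X t).
Qed.

(** [F (X t)] is a finite combination of indicators of the level sets of [X], integrated term by
    term. *)
Lemma expectation_finite (F : I -> R) :
  'E_P[fun t => F (X t)]%E =
  (\sum_i F i * fine (P [set t | X t = i]))%:E.
Proof.
rewrite unlock.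
under eq_integral => t _.
  rewrite (_ : (F (X t))%:E =
    (\sum_i (F i)%:E * (\1_[set t | X t = i] t)%:E)%E); last first.
    rewrite (bigD1 (X t))//= indicE mem_set// mule1 big1 ?adde0// => i iX.
    by rewrite indicE memNset ?mule0// => /= Xi; rewrite Xi eqxx in iX.
  over.
have int1 i : P.-integrable setT (fun t => (\1_[set t | X t = i] t)%:E).
  by apply: integrable_indic => //; exact: mX.
rewrite integral_sum//; last by move=> i; exact: integrableZl.
rewrite -sumEFin; apply: eq_bigr => i _.
rewrite integralZl// integral_indic// setIT EFinM fineK//.
exact: fin_num_measure.
Qed.

End FiniteValued.

(** * The law of the network agrees with the stepwise mean *)

Section RandomNetwork.
Context d (T : measurableType d) (R : realType) (P : probability T R).
Context (m0 m : nat) (U : forall n : nat, T -> graph 'I_(n.-1 + m0)).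
Context (S : forall n : nat, T -> {set 'I_(n.-2 + m0)}).
Hypothesis netU : is_random_network P m U S.
Hypothesis m_le : (m <= m0)%N.

Lemma measurable_pair n (x : graph 'I_(n + m0) * {set 'I_(n + m0)}) :
  (forall g, measurable [set t | U n.+1 t = g]) ->
  measurable [set t | (U n.+1 t, S n.+2 t) = x].
Proof.
case: x => g A mU.
rewrite (_ : [set t | _] = [set t | U n.+1 t = g] `&` [set t | S n.+2 t = A]).
  by apply: measurableI; [exact: mU|exact: (choice_measurable netU)].
by apply/seteqP; split=> t [Ug SA] /=; rewrite ?Ug ?SA.
Qed.

Lemma measurable_network n (g : graph 'I_(n + m0)) :
  measurable [set t | U n.+1 t = g].
Proof.
elim: n g => [|n IHn] g.
  rewrite (_ : [set t | _] = [set t : T | complete_graph 'I_m0 = g]).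
    by case: (pselect (complete_graph 'I_m0 = g)) => gE;
      [rewrite (_ : [set t | _] = setT)|rewrite (_ : [set t | _] = set0)];
      rewrite ?predeqE.
  by apply/seteqP; split=> t /=; rewrite (network_init netU).
rewrite (_ : [set t | _] = (fun t => (U n.+1 t, S n.+2 t)) @^-1`
    [set x | attach x.1 x.2 = g]).
  by apply: measurable_finite_preimage => x; exact: measurable_pair.
by apply/seteqP; split=> t /=; rewrite (network_step netU).
Qed.

Lemma network_history n t t' : U n.+1 t = U n.+1 t' ->
  forall k, (k <= n)%N -> U k.+1 t = U k.+1 t'.
Proof.
elim: n => [|n IHn] tt' k; first by rewrite leqn0 => /eqP ->.
rewrite leq_eqVlt => /predU1P[->//|]; apply: IHn.
by move: tt'; rewrite !(network_step netU) => /attach_inj.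
Qed.

(* The graph at time n determines the whole history, so conditioning on the
   history amounts to conditioning on the current graph. *)
Lemma network_choice n (g : graph 'I_(n + m0)) (A : {set 'I_(n + m0)}) :
  #|A| = m ->
  P [set t | (U n.+1 t, S n.+2 t) = (g, A)] =
  (P [set t | U n.+1 t = g] * ('C(n + m0, m)%:R^-1)%:E)%E.
Proof.
move=> Am.
have -> : [set t | (U n.+1 t, S n.+2 t) = (g, A)] =
    [set t | U n.+1 t = g] `&` [set t | S n.+2 t = A].
  by apply/seteqP; split=> t [Ug SA] /=; rewrite ?Ug ?SA.
(* A sample point with graph [g] supplies the history required by [choice_law]; if there is none,
   both sides are 0. *)
have [[t0 t0g]|nog] := pselect (exists t0, U n.+1 t0 = g); last first.
  rewrite (_ : [set t | U n.+1 t = g] = set0) ?set0I ?measure0 ?mul0e//.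
  by rewrite -subset0 => t Ut; apply: nog; exists t.
have -> : [set t | U n.+1 t = g] =
    [set t | forall k, (1 <= k <= n.+1)%N -> U k t = U k t0].
  apply/seteqP; split=> t /=; last by move=> /(_ n.+1) ->; rewrite ?leqnn.
  rewrite -t0g => /network_history Utk [//|k] kn.
  exact: Utk.
exact: (choice_law netU (fun k => U k t0) Am).
Qed.

Definition choice_prob n (x : graph 'I_(n + m0) * {set 'I_(n + m0)}) : R :=
  fine (P [set t | (U n.+1 t, S n.+2 t) = x]).

Lemma choice_probE n (g : graph 'I_(n + m0)) (A : {set 'I_(n + m0)}) :
  #|A| = m ->
  choice_prob (g, A) = 'C(n + m0, m)%:R^-1 * fine (P [set t | U n.+1 t = g]).
Proof.
move=> Am; rewrite /choice_prob network_choice// fineM ?fin_num_measure//.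
  by rewrite mulrC.
exact: measurable_network.
Qed.

Lemma sum_choice_prob n (F : graph 'I_(n + m0) -> {set 'I_(n + m0)} -> R) :
  \sum_(x : graph 'I_(n + m0) * {set 'I_(n + m0)} | #|x.2| == m) F x.1 x.2 * choice_prob x =
  \sum_g draw_mean m (F g) * fine (P [set t | U n.+1 t = g]).
Proof.
transitivity (\sum_g \sum_(A : {set 'I_(n + m0)} | #|A| == m)
    F g A * choice_prob (g, A)).
  by rewrite pair_big; apply: eq_big => [x|[]].
apply: eq_bigr => g _; rewrite /draw_mean mulrAC mulr_sumr.
by apply: eq_bigr => A /eqP Am; rewrite choice_probE// mulrC.
Qed.

(** [choice_law] only prescribes the probabilities of sets of [m] nodes. These already sum to 1, so
    the remaining nonnegative masses vanish. *)
Lemma choice_prob_eq0 n (x : graph 'I_(n + m0) * {set 'I_(n + m0)}) :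
  #|x.2| != m -> choice_prob x = 0.
Proof.
have E1 (I : finType) (X : T -> I) : (forall i, measurable [set t | X t = i]) ->
    \sum_i fine (P [set t | X t = i]) = 1 :> R.
  move=> mX; apply: EFin_inj; rewrite -(expectation_cst P 1).
  rewrite (expectation_finite P mX (fun=> 1)).
  by congr EFin; apply: eq_bigr => i _; rewrite mul1r.
have := E1 _ _ (fun x => measurable_pair x (@measurable_network n)).
rewrite (bigID (fun x : graph 'I_(n + m0) * {set 'I_(n + m0)} => #|x.2| == m))/=.
have /= := sum_choice_prob (fun (_ : graph 'I_(n + m0)) _ => 1).
under eq_bigr do rewrite mul1r.
under [RHS]eq_bigr do rewrite draw_mean_cst ?(leq_trans m_le) ?leq_addl// mul1r.
rewrite E1; last exact: measurable_network.
move=> -> /eqP; rewrite -subr_eq0 addrAC subrr add0r => /eqP/psumr_eq0P.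
by apply=> y _; rewrite fine_ge0.
Qed.

(** [U n.+2] is a function of the pair [(U n.+1, S n.+2)], whose law factors into the law of the
    graph and a uniform draw; this is one step of [process_mean]. *)
Lemma expectation_network n (F : graph 'I_(n + m0) -> R) :
  'E_P[fun t => F (U n.+1 t)]%E = (process_mean m F)%:E.
Proof.
elim: n F => [|n IHn] F.
  rewrite /= -(expectation_cst P); congr expectation.
  by apply/funext => t; rewrite (network_init netU).
rewrite /= -IHn (expectation_finite P (@measurable_network n)
  (fun g => draw_mean m (fun A => F (attach g A)))).
rewrite -sum_choice_prob.
rewrite (_ : (fun t => _) = (fun t => (fun x => F (attach x.1 x.2))
  (U n.+1 t, S n.+2 t))); last first.
  by apply/funext => t; rewrite (network_step netU).
rewrite (expectation_finite P (fun x => measurable_pair x (@measurable_network n))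
  (fun x => F (attach x.1 x.2))).
congr EFin; rewrite [RHS]big_mkcond/=; apply: eq_bigr => x _.
case: ifPn => // /choice_prob_eq0; rewrite /choice_prob => ->; exact: mulr0.
Qed.

End RandomNetwork.

(** * The vanishing rate, and the conclusion *)

Lemma cvg_div_sqrt_nat (R : realType) (K : R) :
  (K / Num.sqrt n%:R)%:E @[n --> \oo] --> 0%E.
Proof.
apply: cvg_EFin; first exact: nearW.
apply/cvgrPdist_lt => /= e e0.
near=> n; rewrite sub0r normrN.
have n0 : 0 < n%:R :> R by rewrite ltr0n; near: n; exact: nbhs_infty_gt.
have s0 : 0 < Num.sqrt (n%:R : R) by rewrite sqrtr_gt0.
rewrite normrM normfV (gtr0_norm s0) ltr_pdivrMr//.
rewrite -ltr_pdivrMl// -(@ltr_pXn2r _ 2)// ?nnegrE ?sqr_sqrtr ?(ltW n0) ?(ltW s0)//.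
  by near: n; exact: nbhs_infty_gtr.
by rewrite mulr_ge0// invr_ge0 ltW.
Unshelve. all: by end_near. Qed.

Theorem proposition1 (d : measure_display) (T : measurableType d)
    (R : realType) (P : probability T R) (m0 m : nat)
    (U : forall n : nat, T -> graph 'I_(n.-1 + m0))
    (S : forall n : nat, T -> {set 'I_(n.-2 + m0)}) :
  (1 <= m0)%N -> (1 <= m <= m0)%N ->
  is_random_network P m U S ->
  let Z := fun (n : nat) (t : T) => (zagreb (U n t))%:R : R in
  (exists r : nat -> R,
     r =O_\oo (fun n : nat => n%:R : R) /\
     forall n : nat, (1 <= n)%N ->
       'E_P[Z n]%E =
       (((5%:R * m%:R ^+ 2 + m%:R) * n%:R ^+ 2
         - 2%:R * m%:R * m0%:R * (2%:R * m%:R - m0%:R + 1) * (n%:R * ln n%:R)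
         + r n) / (n%:R + m0%:R - 1))%:E) /\
  cvg_in_L1 P (fun n t => Z n t / n%:R) (5%:R * m%:R ^+ 2 + m%:R) /\
  cvg_in_probability P (fun n t => Z n t / n%:R) (5%:R * m%:R ^+ 2 + m%:R).
Proof.
move=> _ /andP[m_gt0 m_le] netU Z; set c : R := 5%:R * m%:R ^+ 2 + m%:R.
set kappa : R := _ * (_ - _ + 1).
have law n (F : graph 'I_(n + m0) -> R) :
    'E_P[fun t => F (U n.+1 t)]%E = (process_mean m F)%:E.
  exact: (expectation_network netU m_le F).
have [K absK] := zagreb_abs_dist_le R m_gt0 m_le.
split; last split.
(* The remainder is defined as the exact error; [n.-1] appears because [zagreb_mean] counts steps
   from [U 1]. *)
- pose r (n : nat) : R := zagreb_mean R m0 m n.-1 * (n%:R + m0%:R - 1) -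
    (c * n%:R ^+ 2 - kappa * (n%:R * ln n%:R)).
  exists r; split.
    have [B B0 asympB] := zagreb_mean_asymp R m_gt0 m_le.
    (* A positive constant is required, while [B] may be 0. *)
    apply/eqO_exP; exists (B + 1); first by rewrite ltr_wpDl.
    near=> n; have n0 : (0 < n)%N by near: n; exact: nbhs_infty_gt.
    rewrite -(prednK n0) /r (ger0_norm (ler0n _ _)).
    apply: (le_trans (asympB n.-1)); rewrite ler_wpM2r//.
    by rewrite lerDl.
  case=> // n _; rewrite (law n (fun g => (zagreb g)%:R)); congr EFin.
  rewrite /r addrC subrK mulfK// -addrA gt_eqF// ltr_wpDr ?ltr0n//.
  by rewrite subr_ge0 ler1n (leq_trans m_gt0).
- have L1E n : ('N[P]_1[(fun t => (Z n.+1 t / n.+1%:R - c)%R%:E)] =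
      (process_mean m (fun g : graph 'I_(n + m0) =>
         `|(zagreb g)%:R / n.+1%:R - c|)%R)%:E)%E.
    by rewrite Lnorm1 -law unlock; apply: eq_integral.
  apply: (squeeze_cvge _ (cvg_cst 0%E) (cvg_div_sqrt_nat K)).
  near=> n; have n0 : (0 < n)%N by near: n; exact: nbhs_infty_gt.
  by rewrite Lnorm_ge0/= -(prednK n0) L1E lee_fin absK.
- move=> e e0.
  have PE n : P [set t | e < `|Z n.+1 t / n.+1%:R - c|] =
      (process_mean m (fun g : graph 'I_(n + m0) =>
         (e < `|(zagreb g)%:R / n.+1%:R - c|)%R%:R))%:E.
    rewrite -law unlock -[X in P X]setIT -integral_indic//.
      by apply: eq_integral => t _; rewrite indicE mem_setE.
    exact: (measurable_finite_preimage (@measurable_network _ _ _ _ _ _ _ _ netU n)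
      [set g | e < `|(zagreb g)%:R / n.+1%:R - c|]).
  apply: (squeeze_cvge _ (cvg_cst 0%E) (cvg_div_sqrt_nat (e^-1 * K))).
  near=> n; have n0 : (0 < n)%N by near: n; exact: nbhs_infty_gt.
  rewrite measure_ge0/= -(prednK n0) PE lee_fin -[leRHS]mulrA.
  (* Markov's inequality: the indicator of [e < |y|] is at most [|y| / e], and the [L1] bound
     applies to [|y|]. *)
  apply: (@le_trans _ _ (process_mean m (fun g : graph 'I_(n.-1 + m0) =>
    e^-1 * `|(zagreb g)%:R / n.-1.+1%:R - c|))); last first.
    by rewrite process_meanZ ler_wpM2l ?invr_ge0 ?(ltW e0).
  apply: ler_process_mean => g _ /=; rewrite ler_pdivlMl//; case: ltP => [/ltW|_].
    by rewrite mulr1.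
  by rewrite mulr0.
Unshelve. all: by end_near. Qed.
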